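(* The number $-\alpha_r$ is an eigenvalue of $\tilde A$ with left eigenvector $c^\top\phi_{r-1}(A)$. Moreover, every eigenvalue $\lambda\in\mathbb{C}$ of $\tilde A$ that is not an eigenvalue of $A_0$ either belongs to $\{-\alpha_i\}_{i=1}^{r}$ or satisfies $$c^\top(\lambda I_n-A_0)^{-1}B\,G^{-1}B^\top (A^\top)^{r-1}c=0 .$$
   Context: Data: $A\in\mathbb{R}^{n\times n}$, $B\in\mathbb{R}^{n\times m}$ with $(A,B)$ stabilizable; $c\in\mathbb{R}^n$, $d\in\mathbb{R}$ with $d>0$; $h(x)=c^\top x+d$; the safe set is $\{x: h(x)\ge 0\}$ for the linear system $\dot x=Ax+Bu$. The integer $r\ge 1$ is the relative degree of $h$: $c^\top A^iB=0$ for $0\le i\le r-2$ and $c^\top A^{r-1}B\neq 0$. $\alpha_1,\dots,\alpha_r>0$ are constants. $G\in\mathbb{R}^{m\times m}$ is symmetric positive definite. $K\in\mathbb{R}^{m\times n}$ is a nominal gain such that $A_0:=A-BK$ is Hurwitz (all eigenvalues have negative real part). Notation: $\phi_i(s)=\prod_{j=1}^{i}(s+\alpha_j)$ for $0\le i\le r$ (with $\phi_0=1$), $\phi=\phi_r$; $\theta=c^\top A^{r-1}B\,G^{-1}B^\top(A^\top)^{r-1}c>0$; $v_1=-\frac{1}{\theta}B\,G^{-1}B^\top(A^\top)^{r-1}c\in\mathbb{R}^n$; $v_2^\top=c^\top(\phi(A)-A^{r-1}BK)$; $\tilde A=A_0+v_1v_2^\top$. A left eigenvector of a matrix $M$ for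 eigenvalue $\mu$ is a nonzero row vector $w^\top$ with $w^\top M=\mu w^\top$. *)

(* Defs.v *)
From mathcomp Require Import all_boot all_order all_algebra.
From mathcomp Require Import reals complex.

Set Implicit Arguments.
Unset Strict Implicit.
Unset Printing Implicit Defensive.

Import Order.TTheory GRing.Theory Num.Theory.
Local Open Scope ring_scope.
Local Open Scope complex_scope.

(* State dimensions have the form n.+1 so that horner_mx is available; input
   dimensions m are arbitrary. *)

Definition cplx (R : realType) m n (M : 'M[R]_(m, n)) : 'M[R[i]]_(m, n) :=
  map_mx (real_complex R) M.

Definition ceigenvalue (R : realType) n (M : 'M[R]_n) (l : R[i]) : Prop :=
  eigenvalue (cplx M) l.

Definition left_eigenvector (F : fieldType) n (M : 'M[F]_n) (mu : F)
    (w : 'rV[F]_n) : Prop :=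
  w != 0 /\ w *m M = mu *: w.

Definition hurwitz (R : realType) n (M : 'M[R]_n) : Prop :=
  forall l : R[i], ceigenvalue M l -> complex.Re l < 0.

Definition stabilizable (R : realType) n m
    (A : 'M[R]_n) (B : 'M[R]_(n, m)) : Prop :=
  exists F : 'M[R]_(m, n), hurwitz (A - B *m F).

Definition sym_posdef (R : realType) m (G : 'M[R]_m) : Prop :=
  G^T = G /\ forall x : 'cV[R]_m, x != 0 -> 0 < (x^T *m G *m x) 0 0.

(* Relative degree of h(x) = c^T x + d along x' = A x + B u; the offset d plays
   no role.  The range 0 <= i <= r - 2 is written i.+1 < r. *)
Definition relative_degree (R : realType) n m (A : 'M[R]_n.+1)
    (B : 'M[R]_(n.+1, m)) (c : 'cV[R]_n.+1) (r : nat) : Prop :=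
  [/\ (1 <= r)%N,
      forall i : nat, (i.+1 < r)%N -> c^T *m A ^+ i *m B = 0
    & c^T *m A ^+ r.-1 *m B != 0].

(* Only the values alpha 1, ..., alpha i of the sequence alpha are used. *)
Definition phi (R : realType) (alpha : nat -> R) (i : nat) : {poly R} :=
  \prod_(1 <= j < i.+1) ('X + (alpha j)%:P).

Section ClosedLoop.

Variables (R : realType) (n m : nat).
Variables (A : 'M[R]_n.+1) (B : 'M[R]_(n.+1, m)) (c : 'cV[R]_n.+1).
Variables (r : nat) (alpha : nat -> R) (G : 'M[R]_m) (K : 'M[R]_(m, n.+1)).

Definition A0 : 'M[R]_n.+1 := A - B *m K.

Definition theta : R :=
  (c^T *m A ^+ r.-1 *m B *m invmx G *m B^T *m A^T ^+ r.-1 *m c) 0 0.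

Definition v1 : 'cV[R]_n.+1 :=
  - theta^-1 *: (B *m invmx G *m B^T *m A^T ^+ r.-1 *m c).

Definition v2T : 'rV[R]_n.+1 :=
  c^T *m (horner_mx A (phi alpha r) - A ^+ r.-1 *m B *m K).

Definition Atilde : 'M[R]_n.+1 := A0 + v1 *m v2T.

End ClosedLoop.

(* Main.v *)
Require Import Defs.
From mathcomp Require Import all_boot all_order all_algebra.
From mathcomp Require Import reals complex.

(** Write w_k = c^T phi_k(A) for k < r, w_r = v2T and
    b = B G^-1 B^T (A^T)^(r-1) c, so that v1 = - b / theta.  Since r is the
    relative degree, w_k B vanishes for k < r - 1 and equals c^T A^(r-1) B for
    k = r - 1: the feedback A0 = A - B K acts on the first rows as A does, and
    v2T is designed to absorb the term c^T A^(r-1) B K when it first shows up.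
    Hence the rows form a chain  w_k A0 = w_(k+1) - alpha_(k+1) w_k  for all
    k < r ([lie_row_A0], [lie_row_last_A0]).

    For the eigenvector: w_(r-1) v1 = -1, so the rank-one correction v1 v2T
    removes w_r from w_(r-1) A0 and leaves - alpha_r w_(r-1).

    For the other eigenvalues: if l is an eigenvalue of A0 + v1 v2T but not of
    A0, then v2T (l - A0)^-1 v1 = 1 ([eigenvalue_rank_one]), that is,
    w_r (l - A0)^-1 b = - theta.  On the other hand, applying the resolvent
    along the chain ([resolvent_chain]) gives
      w_(k+1) (l - A0)^-1 b = (l + alpha_(k+1)) w_k (l - A0)^-1 b - w_k b,
    where w_k b is 0 for k < r - 1 and theta for k = r - 1.  So
      w_r (l - A0)^-1 b = phi_r(l) c^T (l - A0)^-1 b - theta,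
    and comparison yields phi_r(l) c^T (l - A0)^-1 b = 0.  The divisions
    by theta are legitimate: theta = y G^-1 y^T with y = c^T A^(r-1) B nonzero,
    hence theta > 0 ([theta_gt0]). *)

Import Order.TTheory GRing.Theory Num.Theory.
Local Open Scope ring_scope.
Local Open Scope complex_scope.

Lemma unitmx_resolvent (F : fieldType) (n : nat) (M : 'M[F]_n) (l : F) :
  ~~ eigenvalue M l -> l%:M - M \in unitmx.
Proof.
rewrite /eigenvalue negbK kermx_eq0 row_free_unit => uM.
by rewrite -opprB -scaleN1r unitmxZ // unitrN1.
Qed.

(** A left eigenvector z satisfies z (l - M) = (z v) w.  The scalar z v is
    nonzero, as z would otherwise be an eigenvector of M; multiplying by
    (l - M)^-1 v and dividing by z v gives the claim. *)
Lemma eigenvalue_rank_one (F : fieldType) (n : nat) (M : 'M[F]_n)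
    (v : 'cV[F]_n) (w : 'rV[F]_n) (l : F) :
  eigenvalue (M + v *m w) l -> ~~ eigenvalue M l ->
  w *m invmx (l%:M - M) *m v = 1%:M.
Proof.
move=> /eigenvalueP[z zM z0] lM; have uN := unitmx_resolvent _ _ _ _ lM.
move: zM; rewrite mulmxDr mulmxA [z *m v]mx11_scalar mul_scalar_mx.
set a := (z *m v) 0 0 => zM.
have a0 : a != 0.
  apply: contra lM => /eqP a0; apply/eigenvalueP; exists z => //.
  by rewrite -zM a0 scale0r addr0.
have zN : z *m (l%:M - M) = a *: w.
  by rewrite mulmxBr mul_mx_scalar -zM addrC addKr.
apply: (scalerI a0).
rewrite -mulmxA scalemxAl -zN !mulmxA mulmxK //.
by rewrite [z *m v]mx11_scalar -/a scalemx1.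
Qed.

(** The hypothesis reads w (l - M) = (l + a) w - w'; multiply it on the right
    by (l - M)^-1 b. *)
Lemma resolvent_chain (F : fieldType) (n p : nat) (M : 'M[F]_n) (l a : F)
    (w w' : 'rV[F]_n) (b : 'M[F]_(n, p)) :
  l%:M - M \in unitmx -> w *m M = w' - a *: w ->
  w' *m invmx (l%:M - M) *m b
    = (l + a) *: (w *m invmx (l%:M - M) *m b) - w *m b.
Proof.
move=> uN wM.
have -> : w' = (l + a) *: w - w *m (l%:M - M).
  by rewrite mulmxBr mul_mx_scalar wM scalerDl opprB addrC addrA !subrK.
by rewrite !mulmxBl mulmxK // -!scalemxAl.
Qed.

Lemma trmx_exp (R : comNzRingType) (n : nat) (M : 'M[R]_n.+1) (k : nat) :
  (M ^+ k)^T = M^T ^+ k.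
Proof.
by elim: k => [|k IHk]; rewrite ?trmx1 // exprS exprSr trmx_mul IHk.
Qed.

Section Complexification.
Variable R : realType.

Lemma cplxM (m n p : nat) (M : 'M[R]_(m, n)) (N : 'M[R]_(n, p)) :
  cplx (M *m N) = cplx M *m cplx N.
Proof. exact: map_mxM. Qed.

Lemma cplxD (m n : nat) (M N : 'M[R]_(m, n)) :
  cplx (M + N) = cplx M + cplx N.
Proof. exact: map_mxD. Qed.

Lemma cplxB (m n : nat) (M N : 'M[R]_(m, n)) :
  cplx (M - N) = cplx M - cplx N.
Proof. exact: map_mxB. Qed.

Lemma cplxZ (m n : nat) (a : R) (M : 'M[R]_(m, n)) :
  cplx (a *: M) = a%:C *: cplx M.
Proof. exact: map_mxZ. Qed.

End Complexification.

Lemma sym_posdef_unit (R : realType) (m : nat) (G : 'M[R]_m) :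
  sym_posdef G -> G \in unitmx.
Proof.
move=> [_ Gpos]; rewrite -row_free_unit -kermx_eq0.
apply/eqP/row_matrixP => i; rewrite row0; apply: contraTeq isT => u0.
have := Gpos (row i (kermx G))^T; rewrite trmxK -row_mul mulmx_ker row0 mul0mx.
by rewrite mxE ltxx trmx_eq0 => /(_ u0).
Qed.

(** With x = G^-1 y^T the form y G^-1 y^T becomes x^T G x. *)
Lemma sym_posdef_inv (R : realType) (m : nat) (G : 'M[R]_m) (y : 'rV[R]_m) :
  sym_posdef G -> y != 0 -> 0 < (y *m invmx G *m y^T) 0 0.
Proof.
move=> hG y0; have uG := sym_posdef_unit _ _ _ hG; have [Gsym Gpos] := hG.
have := Gpos (invmx G *m y^T).
rewrite trmx_mul trmxK trmx_inv Gsym mulmxKV // mulmxA; apply.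
by apply: contra y0 => /eqP x0; rewrite -trmx_eq0 -(mulKVmx uG y^T) x0 mulmx0.
Qed.

Lemma phi0 (R : realType) (alpha : nat -> R) : phi alpha 0 = 1.
Proof. by rewrite /phi big_geq. Qed.

Lemma horner_mx_phiS (R : realType) (n : nat) (A : 'M[R]_n.+1)
    (alpha : nat -> R) (k : nat) :
  horner_mx A (phi alpha k.+1)
    = horner_mx A (phi alpha k) *m (A + (alpha k.+1)%:M).
Proof.
rewrite /phi big_nat_recr //= rmorphM rmorphD /= horner_mx_X horner_mx_C.
by [].
Qed.

Section RelativeDegree.

Variables (R : realType) (n m : nat).
Variables (A : 'M[R]_n.+1) (B : 'M[R]_(n.+1, m)) (c : 'cV[R]_n.+1).
(* The relative degree is r = s + 1. *)
Variables (s : nat) (hr : relative_degree A B c s.+1) (alpha : nat -> R).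
Variables (G : 'M[R]_m) (hG : sym_posdef G) (K : 'M[R]_(m, n.+1)).

Let b : 'cV[R]_n.+1 := B *m invmx G *m B^T *m A^T ^+ s *m c.

(** For k < r, this row represents the linear part of the k-th function
    psi_k = (d/dt + alpha_k) psi_(k-1), psi_0 = h, along the trajectories. *)
Let lie_row (k : nat) : 'rV[R]_n.+1 := c^T *m horner_mx A (phi alpha k).

Lemma lie_rowS (k : nat) :
  lie_row k.+1 = lie_row k *m A + alpha k.+1 *: lie_row k.
Proof.
by rewrite /lie_row horner_mx_phiS mulmxA mulmxDr mul_mx_scalar.
Qed.

(** phi_k is monic of degree k, so only its leading monomial can reach the
    exponent r - 1.  The extra power A^j makes the induction on k go through
    without any reference to the coefficients of phi_k. *)
Lemma relative_degree_phi (k j : nat) : (j + k <= s)%N ->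
  c^T *m A ^+ j *m horner_mx A (phi alpha k) *m B
    = ((j + k)%N == s)%:R *: (c^T *m A ^+ s *m B).
Proof.
have [_ zeroB _] := hr.
elim: k j => [|k IHk] j.
  rewrite addn0 phi0 rmorph1 mulmx1 leq_eqVlt.
  case: eqP => [-> _ | _ /= js]; first by rewrite mulr1n scale1r.
  by rewrite mulr0n scale0r zeroB.
rewrite addnS => jks.
have -> : c^T *m A ^+ j *m horner_mx A (phi alpha k.+1) *m B
    = c^T *m A ^+ j.+1 *m horner_mx A (phi alpha k) *m B
      + alpha k.+1 *: (c^T *m A ^+ j *m horner_mx A (phi alpha k) *m B).
  rewrite horner_mx_phiS (comm_horner_mx _ (_ : comm_mx A _)); last first.
    by apply: comm_mxD; [exact: comm_mx_refl | exact: comm_mx_scalar].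
  rewrite exprSr -mulmxE !mulmxA mulmxDr mul_mx_scalar !mulmxDl.
  by rewrite -!scalemxAl.
rewrite !IHk ?addSn // 1?ltnW //.
by rewrite (ltn_eqF jks) mulr0n scale0r scaler0 addr0.
Qed.

Lemma lie_row_mulB (k : nat) : (k <= s)%N ->
  lie_row k *m B = (k == s)%:R *: (c^T *m A ^+ s *m B).
Proof. by move=> ks; rewrite -(relative_degree_phi k 0) // expr0 mulmx1. Qed.

Lemma lie_row_last_mulB : lie_row s *m B = c^T *m A ^+ s *m B.
Proof. by rewrite lie_row_mulB // eqxx mulr1n scale1r. Qed.

Lemma lie_row_last_neq0 : lie_row s != 0.
Proof.
have [_ _ cB0] := hr; apply: contraNneq cB0 => /= w0.
by rewrite -lie_row_last_mulB w0 mul0mx.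
Qed.

Lemma lie_row_A0 (k : nat) : (k < s)%N ->
  lie_row k *m A0 A B K = lie_row k.+1 - alpha k.+1 *: lie_row k.
Proof.
move=> ks; rewrite lie_rowS addrK /A0 mulmxBr mulmxA lie_row_mulB 1?ltnW //.
by rewrite (ltn_eqF ks) mulr0n scale0r mul0mx subr0.
Qed.

Lemma lie_row_last_A0 :
  lie_row s *m A0 A B K = v2T A B c s.+1 alpha K - alpha s.+1 *: lie_row s.
Proof.
rewrite /v2T /A0 !mulmxBr -/(lie_row s.+1) lie_rowS !mulmxA.
by rewrite lie_row_last_mulB addrAC addrK.
Qed.

Lemma lie_row_mulb (k : nat) : (k <= s)%N ->
  lie_row k *m b = ((k == s)%:R * theta A B c s.+1 G)%:M.
Proof.
move=> ks; rewrite /b !mulmxA lie_row_mulB // -!scalemxAl /theta /=.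
by rewrite [X in _ *: X]mx11_scalar scale_scalar_mx.
Qed.

Lemma theta_gt0 : 0 < theta A B c s.+1 G.
Proof.
have [_ _ cB0] := hr; have := sym_posdef_inv _ _ _ _ hG cB0.
by rewrite !trmx_mul trmxK trmx_exp /theta !mulmxA.
Qed.

Lemma lie_row_last_v1 : lie_row s *m v1 A B c s.+1 G = (- 1)%:M.
Proof.
rewrite /v1 -/b -scalemxAr lie_row_mulb // eqxx mulr1n mul1r scale_scalar_mx.
by rewrite mulNr mulVf // gt_eqF // theta_gt0.
Qed.

Lemma left_eigenvector_Atilde :
  left_eigenvector (Atilde A B c s.+1 alpha G K) (- alpha s.+1) (lie_row s).
Proof.
split; first exact: lie_row_last_neq0.
rewrite /Atilde mulmxDr mulmxA lie_row_last_v1 mul_scalar_mx scaleN1r.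
by rewrite lie_row_last_A0 addrAC subrr add0r scaleNr.
Qed.

Lemma ceigenvalue_Atilde :
  ceigenvalue (Atilde A B c s.+1 alpha G K) (- alpha s.+1)%:C.
Proof.
rewrite /ceigenvalue /cplx eigenvalue_map; apply/eigenvalueP.
by have [w0 wA] := left_eigenvector_Atilde; exists (lie_row s).
Qed.

Section Resolvent.

Variables (l : R[i]) (hl : ~~ eigenvalue (cplx (A0 A B K)) l).

Let N : 'M[R[i]]_n.+1 := invmx (l%:M - cplx (A0 A B K)).

(** Below the last index the terms w_k b of the chain recursion vanish, so each
    step only contributes its factor l + alpha_(k+1). *)
Lemma lie_row_resolvent (k : nat) : (k <= s)%N ->
  cplx (lie_row k) *m N *m cplx b
    = (\prod_(1 <= j < k.+1) (l + (alpha j)%:C)) *: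
        (cplx c^T *m N *m cplx b).
Proof.
elim: k => [|k IHk] ks.
  by rewrite /lie_row phi0 rmorph1 mulmx1 big_geq // scale1r.
rewrite /N (resolvent_chain _ _ _ _ _ (alpha k.+1)%:C (cplx (lie_row k))).
- rewrite -/N IHk 1?ltnW // -cplxM lie_row_mulb 1?ltnW // (ltn_eqF ks).
  rewrite mulr0n mul0r -scalemx1 scale0r /cplx map_mx0 subr0 scalerA.
  by rewrite [in RHS]big_nat_recr //= mulrC.
- exact: unitmx_resolvent.
by rewrite -cplxM lie_row_A0 // cplxB cplxZ.
Qed.

(** The last step of the chain, where w_(r-1) b = theta appears. *)
Lemma v2T_resolvent :
  cplx (v2T A B c s.+1 alpha K) *m N *m cplx b
    = (\prod_(1 <= j < s.+2) (l + (alpha j)%:C)) *: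
        (cplx c^T *m N *m cplx b)
      - ((theta A B c s.+1 G)%:C)%:M.
Proof.
rewrite /N (resolvent_chain _ _ _ _ _ (alpha s.+1)%:C (cplx (lie_row s))).
- rewrite -/N lie_row_resolvent // -cplxM lie_row_mulb // eqxx mulr1n mul1r.
  rewrite /cplx map_scalar_mx scalerA [in RHS]big_nat_recr //=.
  by rewrite [X in X *: _]mulrC.
- exact: unitmx_resolvent.
by rewrite -cplxM lie_row_last_A0 cplxB cplxZ.
Qed.

Lemma eigenvalue_Atilde_resolvent :
  eigenvalue (cplx (Atilde A B c s.+1 alpha G K)) l ->
  (\prod_(1 <= j < s.+2) (l + (alpha j)%:C)) *:
    (cplx c^T *m N *m cplx b) = 0.
Proof.
rewrite /Atilde cplxD cplxM => /eigenvalue_rank_one /(_ hl).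
rewrite -/N /v1 -/b cplxZ -scalemxAr => vNv.
have th0 := lt0r_neq0 theta_gt0.
(* The term -theta of v2T_resolvent is also the value of v2T (l - A0)^-1 b
   imposed by the eigenvalue, since v1 = - b / theta. *)
apply: (addIr (- ((theta A B c s.+1 G)%:C)%:M)); rewrite -v2T_resolvent add0r.
have a0 : (- (theta A B c s.+1 G)^-1)%:C != 0.
  by rewrite fmorph_eq0 oppr_eq0 invr_eq0.
apply: (scalerI a0); rewrite vNv scalerN scale_scalar_mx -rmorphM mulNr.
by rewrite mulVf // rmorphN rmorph1 raddfN opprK.
Qed.

End Resolvent.

End RelativeDegree.

Theorem lemma3 (R : realType) (n m : nat)
    (A : 'M[R]_n.+1) (B : 'M[R]_(n.+1, m)) (hAB : stabilizable A B)
    (c : 'cV[R]_n.+1) (d : R) (hd : 0 < d)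
    (r : nat) (hr : relative_degree A B c r)
    (alpha : nat -> R) (halpha : forall j : nat, (1 <= j <= r)%N -> 0 < alpha j)
    (G : 'M[R]_m) (hG : sym_posdef G)
    (K : 'M[R]_(m, n.+1)) (hK : hurwitz (A0 A B K)) :
  (ceigenvalue (Atilde A B c r alpha G K) (- alpha r)%:C /\
   left_eigenvector (Atilde A B c r alpha G K) (- alpha r)
     (c^T *m horner_mx A (phi alpha r.-1))) /\
  (forall l : R[i],
     ceigenvalue (Atilde A B c r alpha G K) l ->
     ~ ceigenvalue (A0 A B K) l ->
     (exists2 i : nat, (1 <= i <= r)%N & l = (- alpha i)%:C) \/
     cplx c^T *m invmx (l%:M - cplx (A0 A B K)) *m
       cplx (B *m invmx G *m B^T *m A^T ^+ r.-1 *m c) = 0).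
Proof.
case: r hr {halpha} => [|s] hr; first by case: hr.
rewrite [s.+1.-1]/=; split; first split.
- exact: ceigenvalue_Atilde.
- exact: left_eigenvector_Atilde.
move=> l lA /negP lA0.
have /eqP := eigenvalue_Atilde_resolvent _ _ _ _ _ _ _ hr alpha _ hG _ _ lA0 lA.
rewrite scaler_eq0 prodf_seq_eq0 => /orP[/hasP[j]|/eqP]; last by right.
rewrite mem_index_iota ltnS addr_eq0 => jr /= /eqP ->.
by left; exists j; rewrite ?rmorphN.
Qed.
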